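(* For every $\varepsilon>0$ there exist $\delta_0>0$ and $n_0\in\mathbb{N}$ such that for all $\delta$ with $0<\delta<\delta_0$ (and $\delta<1$) and all $n>n_0$, setting $m=\lfloor(1-\delta)n\rfloor$, one has $$\mathrm{P}\left[U\geq m\varepsilon\right]<\varepsilon,$$ where $U$ is the number of indices $i\in\{1,\dots,m\}$ at which the optimal alignment of the random sequences $X=X_1\dots X_m$ and $Y=Y_1\dots Y_n$ is not unique (as defined in the context).
   Context: Let $0<\delta<1$, $n\in\mathbb{N}$, $m=\lfloor(1-\delta)n\rfloor$, and $\mathbb{N}_k:=\{1,\dots,k\}$. The variables $X_1,\dots,X_m,Y_1,\dots,Y_n$ are i.i.d. Bernoulli variables with parameter $1/2$, with values in $\{0,1\}$. An alignment (with gaps in $X$ only) is a strictly increasing map $\xi:\mathbb{N}_m\to\mathbb{N}_n$, meaning that $X_i$ is aligned with $Y_{\xi(i)}$ and all other $Y_j$ are aligned with gaps. Its score is $S(X,Y;\xi)=\#\{i\in\mathbb{N}_m: X_i=Y_{\xi(i)}\}$. The (random) set of optimal alignments $\mathcal{OA}_{X,Y}$ is the set of alignments $\xi$ that maximize $S(X,Y;\xi)$. Finally $$U:=\#\{i\in\mathbb{N}_m:\ \exists\,\xi,\lambda\in\mathcal{OA}_{X,Y}\text{ such that }\xi(i)\neq\lambda(i)\}.$$ *)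

(* Defs.v *)
From HB Require Import structures.
From mathcomp Require Import all_boot all_order all_algebra.
From mathcomp Require Import all_classical all_reals all_analysis.

Set Implicit Arguments.
Unset Strict Implicit.
Unset Printing Implicit Defensive.

Import Order.TTheory GRing.Theory Num.Theory.
Local Open Scope classical_set_scope.
Local Open Scope ring_scope.

(* Indices are 0-based: 'I_k stands for {1, ..., k}. Gaps occur in x only, so
   an alignment is just a strictly increasing map of indices. *)
Definition alignments (m n : nat) : {set {ffun 'I_m -> 'I_n}} :=
  [set xi : {ffun 'I_m -> 'I_n} |
    [forall i : 'I_m, forall j : 'I_m, (i < j)%N ==> (xi i < xi j)%N]]%SET.

Definition score (m n : nat) (x : 'I_m -> bool) (y : 'I_n -> bool)
    (xi : {ffun 'I_m -> 'I_n}) : nat :=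
  #|[set i : 'I_m | x i == y (xi i)]%SET|.

Definition optimal_alignments (m n : nat)
    (x : 'I_m -> bool) (y : 'I_n -> bool) : {set {ffun 'I_m -> 'I_n}} :=
  [set xi in alignments m n |
    [forall la in alignments m n, (score x y la <= score x y xi)%N]]%SET.

Definition nonuniqueness (m n : nat)
    (x : 'I_m -> bool) (y : 'I_n -> bool) : nat :=
  #|[set i : 'I_m | [exists xi in optimal_alignments x y,
      exists la in optimal_alignments x y, xi i != la i]]%SET|.

Definition mutually_independent d d' (T : measurableType d)
    (T' : measurableType d') (R : realType) (P : probability T R)
    (I : finType) (Z : I -> {RV P >-> T'}) : Prop :=
  forall (J : {set I}) (A : I -> set T'),
    (forall i, measurable (A i)) ->
    P [set w | forall i, i \in J -> A i (Z i w)] =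
    (\prod_(i in J) P (Z i @^-1` A i))%E.

Definition iid_bernoulli d (T : measurableType d) (R : realType)
    (P : probability T R) (p : R) (I : finType) (Z : I -> {RV P >-> bool})
    : Prop :=
  mutually_independent Z /\
  forall i (A : set bool), distribution P (Z i) A = bernoulli_prob p A.

Definition join_families (I J : Type) (V : Type) (X : I -> V) (Y : J -> V)
    (k : I + J) : V :=
  match k with inl i => X i | inr j => Y j end.

(* Main.v *)
Require Import Defs.
From mathcomp Require Import all_boot all_order all_algebra.
From mathcomp Require Import all_classical all_reals all_analysis.
From mathcomp Require Import zify ring lra.

Import Order.TTheory GRing.Theory Num.Theory.
Local Open Scope classical_set_scope.
Local Open Scope ring_scope.

Set Implicit Arguments.
Unset Strict Implicit.
Unset Printing Implicit Defensive.

(** Call an index [i] mismatchable if some optimal alignment pairs [X_i] with a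
different letter, and let [M] be the number of mismatchable indices.

Flipping the letter [X_i] raises the optimal score by one if [i] is
mismatchable, and lowers it by at most one otherwise. A flip preserves the
uniform distribution of the words, so the mean change of the score is zero;
summing over [i] gives E[M] <= m / 2 ([sum_mismatchable]).

On the other hand, the optimal alignments are closed under pointwise minimum and
maximum, hence lie between a lowest one [lo] and a highest one [hi]
([extremal_optimal]), and [U] is the number of indices where [lo] and [hi]
differ. The number [M] is at least the number of indices that are mismatched by
[lo] or by [hi]. For a fixed pair lo <= hi that differs at D indices, this last
number has mean m / 2 + D / 4, since there are two chances of a mismatch where
[lo] and [hi] differ. It is moreover a sum of independent bits: the comparisons made by [lo] and [hi] are
the edges of a forest on the letters of [X] and [Y], so a triangular change of
variables makes them independent ([sum_prod_mismatch]). The exponential moments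
are therefore Gaussian, and if there are at most e^k alignments, a union bound
over the e^(2k) pairs shows that the largest deviation has mean at most
(2 k + m t^2) / t for every small [t]. Comparing with E[M] <= m / 2,
E[U] <= 4 (2 k + m t^2) / t ([mean_nonuniqueness]).

With few gaps there are few alignments: [k] is at most any prescribed fraction
of [m] when [delta] is small and [n] large ([entropy_small]). With [t] of order
eps^2, Markov's inequality concludes. *)

(** * The lattice of optimal alignments *)

Section Lattice.
Local Open Scope nat_scope.
Variables (m n : nat).
Implicit Types (x : 'I_m -> bool) (y : 'I_n -> bool).
Implicit Types xi la lo hi : {ffun 'I_m -> 'I_n}.

Lemma alignmentsP xi :
  reflect {homo xi : i j / i < j} (xi \in alignments m n).
Proof.
rewrite inE; apply: (iffP forallP) => [inc i j ij|inc i].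
  by have /forallP/(_ j)/implyP := inc i; apply.
by apply/forallP => j; apply/implyP; apply: inc.
Qed.

Lemma alignment_inj xi : xi \in alignments m n -> injective xi.
Proof.
move=> /alignmentsP inc i j eq_ij; apply: val_inj => /=.
case: (ltngtP i j) => // /inc; by rewrite eq_ij ltnn.
Qed.

Lemma scoreE x y xi : score x y xi = \sum_i (x i == y (xi i)).
Proof.
rewrite /score -sum1_card big_mkcond /=; apply: eq_bigr => i _.
by rewrite inE; case: eqP.
Qed.

Lemma optimalP x y xi :
  reflect (xi \in alignments m n /\
           forall la, la \in alignments m n -> score x y la <= score x y xi)
    (xi \in optimal_alignments x y).
Proof.
rewrite [X in reflect _ X]finset.in_set; apply: (iffP andP) => -[Axi opt]; split => //.
  by move=> la Ala; have /forall_inP := opt; apply.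
by apply/forall_inP.
Qed.

Definition pointwise_max xi la := [ffun i => if xi i < la i then la i else xi i].
Definition pointwise_min xi la := [ffun i => if xi i < la i then xi i else la i].

Lemma pointwise_max_alignment xi la : xi \in alignments m n ->
  la \in alignments m n -> pointwise_max xi la \in alignments m n.
Proof.
move=> /alignmentsP xi_inc /alignmentsP la_inc; apply/alignmentsP => i j ij.
have := xi_inc _ _ ij; have := la_inc _ _ ij; rewrite !ffunE.
by case: (ltnP (xi i) (la i)); case: (ltnP (xi j) (la j)); lia.
Qed.

Lemma pointwise_min_alignment xi la : xi \in alignments m n ->
  la \in alignments m n -> pointwise_min xi la \in alignments m n.
Proof.
move=> /alignmentsP xi_inc /alignmentsP la_inc; apply/alignmentsP => i j ij.
have := xi_inc _ _ ij; have := la_inc _ _ ij; rewrite !ffunE.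
by case: (ltnP (xi i) (la i)); case: (ltnP (xi j) (la j)); lia.
Qed.

(** Position by position, maximum and minimum use the same two letters of [y]. *)
Lemma score_max_min x y xi la :
  score x y (pointwise_max xi la) + score x y (pointwise_min xi la) =
  score x y xi + score x y la.
Proof.
rewrite !scoreE -!big_split /=; apply: eq_bigr => i _.
by rewrite !ffunE; case: ifP => // _; rewrite addnC.
Qed.

(** Both scores are at most the optimum and they sum to twice the optimum. *)
Lemma max_min_optimal x y xi la :
  xi \in optimal_alignments x y -> la \in optimal_alignments x y ->
  pointwise_max xi la \in optimal_alignments x y /\
  pointwise_min xi la \in optimal_alignments x y.
Proof.
move=> /optimalP[Axi xi_max] /optimalP[Ala la_max].
have Aj := pointwise_max_alignment Axi Ala; have Am := pointwise_min_alignment Axi Ala.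
have := score_max_min x y xi la.
have := xi_max _ Aj; have := la_max _ Aj.
have := xi_max _ Am; have := la_max _ Am.
move=> m1 m2 j1 j2 sumE.
split; apply/optimalP; split=> // mu Amu; have := xi_max _ Amu; lia.
Qed.

(** An optimal alignment with the largest (smallest) sum of positions equals
    its maximum (minimum) with any other, hence bounds all of them. *)
Lemma extremal_optimal x y xi0 : xi0 \in optimal_alignments x y ->
  exists lo hi, [/\ lo \in optimal_alignments x y,
    hi \in optimal_alignments x y &
    forall xi, xi \in optimal_alignments x y -> forall i, lo i <= xi i <= hi i].
Proof.
move=> Oxi0; pose height xi := \sum_i nat_of_ord (xi i).
have [hi Ohi hi_max] := arg_maxnP height Oxi0.
have [lo Olo lo_min] := arg_minnP height Oxi0.
exists lo, hi; split => // xi Oxi i.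
have [Oj _] := max_min_optimal Ohi Oxi.
have [_ Om] := max_min_optimal Olo Oxi.
apply/andP; split; rewrite leqNgt; apply/negP => lt_i.
  suff: height (pointwise_min lo xi) < height lo by have := lo_min _ Om; lia.
  rewrite /height (bigD1 i) //= [ltnRHS](bigD1 i) //= ffunE (ltnNge (lo i)) (ltnW lt_i) /=.
  rewrite -addSn; apply: leq_add => //; apply: leq_sum => j _.
  by rewrite ffunE; case: ltnP.
suff: height hi < height (pointwise_max hi xi) by have := hi_max _ Oj; lia.
rewrite /height (bigD1 i) //= [ltnRHS](bigD1 i) //= ffunE lt_i.
rewrite -addSn; apply: leq_add => //; apply: leq_sum => j _.
by rewrite ffunE; case: ltnP => // /ltnW.
Qed.

Lemma nonuniqueness_extremal x y lo hi :
  lo \in optimal_alignments x y -> hi \in optimal_alignments x y ->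
  (forall xi, xi \in optimal_alignments x y -> forall i, lo i <= xi i <= hi i) ->
  nonuniqueness x y = #|[set i | lo i != hi i]%SET|.
Proof.
move=> Olo Ohi lohi; rewrite /nonuniqueness; congr #|pred_of_set _|.
apply/setP => i; rewrite !inE; apply/exists_inP/idP => [[xi Oxi]|neq_i].
  case/exists_inP => la Ola; apply: contraNneq => /(congr1 val) /= eq_i.
  apply/eqP/val_inj => /=.
  by have := lohi _ Oxi i; have := lohi _ Ola i; lia.
by exists lo => //; apply/exists_inP; exists hi.
Qed.

End Lattice.

(** * Flipping one letter of the first sequence *)

Section Flip.
Local Open Scope nat_scope.
Variables (m n : nat).
Implicit Types (x : {ffun 'I_m -> bool}) (y : 'I_n -> bool).

Definition flip x i : {ffun 'I_m -> bool} := [ffun k => x k (+) (k == i)].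

Lemma flipK i : involutive (flip ^~ i).
Proof. by move=> x; apply/ffunP => k; rewrite !ffunE addbK. Qed.

Definition mismatchable x y : {set 'I_m} :=
  [set i | [exists xi in optimal_alignments x y, x i != y (xi i)]]%SET.

Definition best x y := \max_(xi in alignments m n) score x y xi.

Lemma score_leq_best x y xi :
  xi \in alignments m n -> score x y xi <= best x y.
Proof. by move=> Axi; rewrite /best (bigop.bigmax_sup xi). Qed.

Lemma score_flip x y i xi :
  score (flip x i) y xi + (x i == y (xi i)) =
  score x y xi + (x i != y (xi i)).
Proof.
rewrite !scoreE (bigD1 i) //= [in RHS](bigD1 i) //= !ffunE eqxx addbT.
under eq_bigr => k /negbTE ki do rewrite ffunE ki addbF.
rewrite addnAC [in RHS]addnAC; congr (_ + _).
by case: (x i); case: (y _).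
Qed.

Lemma best_optimal x y xi :
  xi \in optimal_alignments x y -> best x y = score x y xi.
Proof.
case/optimalP => Axi xi_max; apply/eqP; rewrite eqn_leq; apply/andP; split.
  exact/bigmax_leqP.
exact: score_leq_best.
Qed.

(** An optimal alignment that mismatches [i] gains a point by the flip; in any
    case an alignment loses at most one. Both claims become one inequality when
    the gain counts double against a default loss of one. *)
Lemma best_flip x y i :
  best x y + (i \in mismatchable x y).*2 <= best (flip x i) y + 1.
Proof.
have [|_] := boolP (i \in mismatchable x y); last first.
  rewrite addn0; apply/bigmax_leqP => xi Axi.
  apply: (@leq_trans (score (flip x i) y xi + 1)).
    by have := score_flip x y i xi; case: eqP => /=; lia.
  by rewrite leq_add2r score_leq_best.
rewrite inE => /exists_inP[xi Oxi mis]; rewrite (best_optimal Oxi).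
have := score_flip x y i xi; rewrite mis (negbTE mis) addn0 => flipE.
have /optimalP[Axi _] := Oxi.
have := score_leq_best (flip x i) y Axi.
rewrite flipE /=; lia.
Qed.

(** Flipping a letter preserves the uniform distribution on [x], so the mean
    change of the optimal score is zero: the gains, one for every mismatchable
    index, cannot outnumber the other indices on average. *)
Lemma sum_mismatchable y :
  (\sum_x #|mismatchable x y|).*2 <= m * #|{ffun 'I_m -> bool}|.
Proof.
have sum_flip i : \sum_x best (flip x i) y = \sum_x best x y.
  by rewrite [RHS](reindex_inj (inv_inj (flipK i))).
have: \sum_i \sum_x (best x y + (i \in mismatchable x y).*2) <=
      \sum_(i < m) \sum_x (best (flip x i) y + 1).
  by apply: leq_sum => i _; apply: leq_sum => x _; apply: best_flip.
under eq_bigr => i _ do rewrite big_split /=.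
under [X in _ <= X]eq_bigr => i _ do
  rewrite big_split /= sum_flip sum1_card.
rewrite !big_split /= leq_add2l [X in _ <= X]sum_nat_const card_ord.
apply: leq_trans; rewrite exchange_big /= -muln2 big_distrl /=.
apply: leq_sum => x _; rewrite -sum1_card big_mkcond big_distrl /=.
by apply: leq_sum => i _; case: ifP.
Qed.

End Flip.

(** * Exponential moments of the number of mismatches *)

Section Moments.
Variable R : realType.

(** Distinct coordinates of a uniform word are independent fair bits; a
    coordinate outside the image of [f] contributes the factor 2. *)
Lemma sum_prod_inj (I J : finType) (f : I -> J) (h : I -> bool -> R) :
  injective f ->
  \sum_(v : {ffun J -> bool}) \prod_i h i (v (f i)) =
  2 ^+ #|J| * \prod_i ((h i false + h i true) / 2).
Proof.
move=> f_inj.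
have by_fibres (v : {ffun J -> bool}) :
    \prod_i h i (v (f i)) = \prod_j \prod_(i | f i == j) h i (v j).
  rewrite (partition_big f xpredT) //=.
  by apply: eq_bigr => j _; apply: eq_bigr => i /eqP->.
rewrite (eq_bigr _ (fun v _ => by_fibres v)).
rewrite -(bigA_distr_bigA (fun j b => \prod_(i | f i == j) h i b)) /=.
rewrite -prodr_const [in RHS](partition_big f xpredT) //= -big_split /=.
apply: eq_bigr => j _; rewrite big_bool /=.
have [i /eqP <-|none] := pickP (fun i => f i == j).
  have fibre k : (f k == f i) = (k == i) by rewrite (inj_eq f_inj).
  by rewrite !(eq_bigl _ _ fibre) !big_pred1_eq mulrC divfK // addrC.
by rewrite !(eq_bigl _ _ none) !big_pred0_eq mulr1.
Qed.

(** The bound [1 - a <= expR (- a)] gives [expR a <= (1 - a)^-1], and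
    [(1 - a) * (1 + a + 2 * a ^+ 2)] is at least 1 in this range. *)
Lemma expR_le_quadratic (a : R) : a <= 1 / 2 -> expR a <= 1 + a + 2 * a ^+ 2.
Proof.
move=> a_le; have := expR_ge1Dx (- a); rewrite expRN => le_inv.
have a1 : 0 < 1 - a by lra.
have e0 := expR_gt0 a.
have : (1 - a) * expR a <= 1.
  by rewrite -ler_pdivlMr // div1r.
have : 0 <= a ^+ 2 by apply: sqr_ge0.
rewrite expr2; nra.
Qed.

End Moments.

Notation words m n := ({ffun 'I_m -> bool} * {ffun 'I_n -> bool})%type.

Section Exposure.
Variables (R : realType) (m n : nat) (lo hi : {ffun 'I_m -> 'I_n}).
Hypotheses (Alo : lo \in alignments m n) (Ahi : hi \in alignments m n)
  (lohi : forall i, (lo i <= hi i)%N).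

Implicit Types p q : words m n.

Definition mismatch_either (x : 'I_m -> bool) (y : 'I_n -> bool) i :=
  (x i != y (lo i)) || (x i != y (hi i)).

(** Exclusive or with [X_i] turns the letters compared with [X_i] into the
    outcomes of the comparisons. For each index, [hi] reaches a letter of [Y]
    that no smaller index was compared with; where [hi] differs from [lo], that
    letter stores the comparison made by [hi]. The position of [X_i] always
    stores the comparison made by [lo]. *)
Definition expose p : words m n :=
  ([ffun i => p.1 i (+) p.2 (lo i)],
   [ffun j => p.2 j (+) [exists i, [&& lo i != hi i, hi i == j & p.1 i]]]).

Lemma expose_hi p i : (expose p).2 (hi i) = p.2 (hi i) (+) (lo i != hi i) && p.1 i.
Proof.
rewrite ffunE; congr (_ (+) _); apply/existsP/andP => [[k]|[Di xi]].
  by case/and3P => Dk /eqP/(alignment_inj Ahi) <-.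
by exists i; rewrite Di eqxx.
Qed.

Lemma mismatch_either_expose p i :
  mismatch_either p.1 p.2 i =
  (expose p).1 i || (lo i != hi i) && (expose p).2 (hi i).
Proof.
rewrite expose_hi ffunE /mismatch_either; case: (lo i =P hi i) => [->|_] /=.
  by rewrite orbF orbb addbC; case: (p.1 i); case: (p.2 _).
by case: (p.1 i); case: (p.2 (lo i)); case: (p.2 (hi i)).
Qed.

(** The letters [x i] are recovered in increasing order of [i]: the letter
    [y (lo i)] depends only on the letters [x k] with [k < i], because
    [lo i <= lo k <= hi k] for [k >= i], with a strict inequality where [hi k]
    stores a comparison. *)
Lemma expose_inj : injective expose.
Proof.
move=> [x y] [x' y'] [/ffunP eq1 /ffunP eq2].
have eqy j : (forall i, lo i != hi i -> hi i = j -> x i = x' i) -> y j = y' j.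
  move=> eqx; have := eq2 j; rewrite !ffunE /=.
  suff -> : [exists i, [&& lo i != hi i, hi i == j & x i]] =
            [exists i, [&& lo i != hi i, hi i == j & x' i]] by exact: addIb.
  apply: eq_existsb => i; case: eqVneq => //= ne; case: eqVneq => //= /eqx -> //.
suff eqx i : x i = x' i.
  by congr pair; apply/ffunP => // j; apply: eqy.
have [k] := ubnP i; elim: k i => // k IH i ik.
have := eq1 i; rewrite !ffunE /= (_ : y (lo i) = y' (lo i)); first exact: addIb.
apply: eqy => k' Dk hik; apply: IH.
apply: (@leq_trans i) => //; rewrite ltnNge; apply/negP => ik'.
move: Dk; rewrite hik -(inj_eq val_inj) /=; apply/negP; rewrite negbK.
have := lohi k'; rewrite hik; move: ik'; rewrite leq_eqVlt => /orP[/eqP/val_inj ->|].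
  by rewrite eqxx.
by have /alignmentsP inc := Alo; move=> /inc; lia.
Qed.

(** By the change of variables [expose], the mismatches of the different indices
    are independent, each occurring with probability 3/4 where [lo] and [hi]
    differ and 1/2 elsewhere. *)
Lemma sum_prod_mismatch (F : 'I_m -> bool -> R) :
  \sum_(p : words m n) \prod_i F i (mismatch_either p.1 p.2 i) =
  2 ^+ m * 2 ^+ n * \prod_i (if lo i != hi i then (F i false + 3 * F i true) / 4
                             else (F i false + F i true) / 2).
Proof.
pose G (q : words m n) :=
  \prod_i F i (q.1 i || (lo i != hi i) && q.2 (hi i)).
rewrite (eq_bigr (G \o expose)) => [|p _]; last first.
  by apply: eq_bigr => i _; rewrite mismatch_either_expose.
rewrite -[LHS](reindex_inj (F := G) (P := xpredT) expose_inj) /=.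
rewrite -(pair_bigA _ (fun u v => G (u, v))) /= exchange_big /=.
pose g i b := (F i ((lo i != hi i) && b) + F i true) / 2.
rewrite (eq_bigr (fun v : {ffun 'I_n -> bool} =>
    2 ^+ m * \prod_i g i (v (hi i)))) => [|v _]; last first.
  pose h i b := F i (b || (lo i != hi i) && v (hi i)).
  by rewrite [LHS](sum_prod_inj h (@inj_id _)) card_ord.
rewrite -big_distrr /= (sum_prod_inj g (alignment_inj Ahi)) card_ord mulrA.
congr (_ * _); apply: eq_bigr => i _; rewrite /g.
by case: ifP => _ /=; field.
Qed.

End Exposure.

(** * The mean number of non-unique positions *)

Section Mean.
Variables (R : realType) (m n : nat).

(** The mean number of indices mismatched by [lo] or [hi], over uniform words,
    minus the actual number. *)
Definition discrepancy (lo hi : {ffun 'I_m -> 'I_n}) x y : R :=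
  \sum_i (1 / 2 + (lo i != hi i)%:R / 4 - (mismatch_either lo hi x y i)%:R).

(** The terms are independent and centred, so the linear part of the bound
    [expR_le_quadratic] averages out and each term contributes a factor at most
    [1 + t ^+ 2]. *)
Lemma discrepancy_mgf (lo hi : {ffun 'I_m -> 'I_n}) (t : R) :
  lo \in alignments m n -> hi \in alignments m n ->
  (forall i, lo i <= hi i)%N -> 0 <= t <= 1 / 2 ->
  \sum_(p : words m n)
    expR (t * discrepancy lo hi p.1 p.2) <= 2 ^+ m * 2 ^+ n * expR (m%:R * t ^+ 2).
Proof.
move=> Alo Ahi lohi /andP[t0 t2].
pose F i (z : bool) : R := expR (t * (1 / 2 + (lo i != hi i)%:R / 4 - z%:R)).
rewrite (eq_bigr (fun p : words m n => \prod_i F i (mismatch_either lo hi p.1 p.2 i))); last first.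
  by move=> p _; rewrite /discrepancy mulr_sumr expR_sum.
rewrite sum_prod_mismatch // ler_wpM2l ?mulr_ge0 ?exprn_ge0 //.
rewrite expRM_natl -[X in _ ^+ X](card_ord m) -prodr_const.
apply: ler_prod => i _; rewrite /F; apply/andP; split.
  by case: ifP => _; rewrite divr_ge0 ?addr_ge0 ?mulr_ge0 ?expR_ge0.
apply: le_trans (expR_ge1Dx (t ^+ 2)).
have t2_ge0 : 0 <= t ^+ 2 by apply: sqr_ge0.
have quad (s : R) : s <= 1 -> expR (t * s) <= 1 + t * s + 2 * s ^+ 2 * t ^+ 2.
  move=> s1; rewrite (le_trans (expR_le_quadratic _)) //; first nra.
  by rewrite le_eqVlt; apply/orP; left; apply/eqP; ring.
case: (lo i != hi i); rewrite /= ?mulr0n ?mulr1n.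
  have := quad (1 / 2 + 1 / 4 - 0) ltac:(lra).
  have := quad (1 / 2 + 1 / 4 - 1) ltac:(lra).
  set e1 := expR _; set e0 := expR _; lra.
have := quad (1 / 2 + 0 / 4 - 0) ltac:(lra).
have := quad (1 / 2 + 0 / 4 - 1) ltac:(lra).
set e1 := expR _; set e0 := expR _; lra.
Qed.

Lemma optimal_exists x y : (m <= n)%N ->
  exists xi : {ffun 'I_m -> 'I_n}, xi \in optimal_alignments x y.
Proof.
move=> mn; pose xi0 : {ffun 'I_m -> 'I_n} := [ffun i => widen_ord mn i].
have Axi0 : xi0 \in alignments m n.
  by apply/alignmentsP => i j ij; rewrite !ffunE.
have [xi Axi xi_max] := arg_maxnP (score x y) Axi0.
by exists xi; apply/optimalP.
Qed.

Definition ordered_pair (q : {ffun 'I_m -> 'I_n} * {ffun 'I_m -> 'I_n}) :=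
  [&& q.1 \in alignments m n, q.2 \in alignments m n &
      [forall i, (q.1 i <= q.2 i)%N]].

(** The pair is that of the lowest and the highest optimal alignment: its
    mismatches occur at mismatchable indices. *)
Lemma nonuniqueness_discrepancy (x : {ffun 'I_m -> bool})
    (y : {ffun 'I_n -> bool}) : (m <= n)%N ->
  exists2 q, ordered_pair q &
    m%:R / 2 + (nonuniqueness x y)%:R / 4 - #|mismatchable x y|%:R <=
    discrepancy q.1 q.2 x y.
Proof.
move=> mn; have [xi Oxi] := optimal_exists x y mn.
have [lo [hi [Olo Ohi lohi]]] := extremal_optimal Oxi.
have /optimalP[Alo _] := Olo; have /optimalP[Ahi _] := Ohi.
exists (lo, hi) => /=.
  apply/and3P; split=> //; apply/forallP => i.
  by have /andP[] := lohi _ Ohi i.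
rewrite (nonuniqueness_extremal Olo Ohi lohi) /discrepancy.
rewrite sumrB big_split /= sumr_const card_ord -mulr_suml -!natr_sum.
rewrite -(mulr_natl (1 / 2) m) mulrA mulr1 lerB //.
  rewrite lerD2l ler_pM2r ?invr_gt0 // ler_nat.
  rewrite -sum1_card big_mkcond /=.
  by apply: leq_sum => i _; rewrite inE; case: ifP.
rewrite ler_nat -sum1_card [leqRHS]big_mkcond /=.
apply: leq_sum => i _.
case: ifPn => [|]; first by case: mismatch_either.
rewrite inE => /exists_inPn none.
by rewrite /mismatch_either !(negPf (none _ _)).
Qed.

(** The tangent inequality [1 + (z - c) <= expR (z - c)] turns the union bound on
    the exponential moment of the largest discrepancy into a bound on its mean;
    [c] is chosen to make the mean of the right-hand side at most 1. The mean of
    the mismatchable indices, at most [m / 2], cancels the constant term. *)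
Lemma mean_nonuniqueness (t k : R) : (m <= n)%N -> 0 < t <= 1 / 2 ->
  #|alignments m n|%:R <= expR k ->
  t * \sum_(p : words m n) (nonuniqueness p.1 p.2)%:R <=
  4 * (2 * k + m%:R * t ^+ 2) * (2 ^+ m * 2 ^+ n).
Proof.
move=> mn /andP[t0 t2] Ak; set c := 2 * k + _.
pose U (p : words m n) : R := (nonuniqueness p.1 p.2)%:R.
pose M (p : words m n) : R := #|mismatchable p.1 p.2|%:R.
have card_p : \sum_(p : words m n) (1 : R) = 2 ^+ m * 2 ^+ n.
  rewrite sumr_const card_prod !card_ffun !card_ord card_bool.
  by rewrite natrM !natrX.
have sumM : \sum_p M p <= m%:R / 2 * (2 ^+ m * 2 ^+ n).
  rewrite -(pair_bigA _ (fun x y => M (x, y))) /= exchange_big /=.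
  rewrite [X in _ * X]mulrC mulrA -natrX.
  rewrite -[(2 ^ n)%N in X in _ <= X](_ : #|{ffun 'I_n -> bool}| = _); last first.
    by rewrite card_ffun card_ord card_bool.
  rewrite mulrAC mulr_natr -sumr_const; apply: ler_sum => y _.
  have := @sum_mismatchable m n y; rewrite -(ler_nat R).
  rewrite card_ffun card_ord card_bool natrM natrX -muln2 natrM natr_sum /M /=.
  lra.
have tangent p : 1 + (t * (m%:R / 2 + U p / 4 - M p) - c) <=
    expR (- c) * \sum_(q | ordered_pair q) expR (t * discrepancy q.1 q.2 p.1 p.2).
  apply: le_trans (expR_ge1Dx _) _; rewrite addrC expRD ler_pM2l ?expR_gt0 //.
  have [q oq le_q] := nonuniqueness_discrepancy p.1 p.2 mn.
  apply: (@le_trans _ _ (expR (t * discrepancy q.1 q.2 p.1 p.2))).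
    by rewrite ler_expR ler_pM2l.
  rewrite (bigD1 q) //= lerDl sumr_ge0 // => ? _; exact: expR_ge0.
have total : \sum_p (1 + (t * (m%:R / 2 + U p / 4 - M p) - c)) <= 2 ^+ m * 2 ^+ n.
  apply: le_trans (ler_sum _ (fun p _ => tangent p)) _.
  rewrite -mulr_sumr exchange_big /=.
  rewrite expRN mulrC ler_pdivrMr ?expR_gt0 //.
  apply: (@le_trans _ _ (\sum_(q | ordered_pair q)
      (2 ^+ m * 2 ^+ n * expR (m%:R * t ^+ 2) : R))).
    apply: ler_sum => q /and3P[A1 A2 /forallP le12].
    by apply: discrepancy_mgf; rewrite // ltW.
  rewrite sumr_const -[X in X <= _]mulr_natr -mulrA ler_pM2l ?mulr_gt0 ?exprn_gt0 //.
  rewrite /c expRD [leRHS]mulrC ler_pM2l ?expR_gt0 //.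
  apply: (@le_trans _ _ (#|alignments m n|%:R * #|alignments m n|%:R)).
    rewrite -natrM ler_nat -cardsX; apply: subset_leq_card.
    by apply/fintype.subsetP => -[q1 q2] /and3P[A1 A2 _]; rewrite finset.in_setX A1.
  by rewrite (mulr_natl k 2) mulr2n expRD ler_pM.
have split_sum : \sum_p (1 + (t * (m%:R / 2 + U p / 4 - M p) - c)) =
    (1 + t * m%:R / 2 - c) * (2 ^+ m * 2 ^+ n) + t / 4 * \sum_p U p -
    t * \sum_p M p.
  rewrite -card_p !mulr_sumr -big_split -sumrB /=.
  by apply: eq_bigr => p _; field.
move: total sumM; rewrite split_sum /U.
set N := 2 ^+ m * 2 ^+ n; set SU := \sum_p _ ; set SM := \sum_p _; nra.
Qed.

End Mean.

(** * Counting alignments *)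

Lemma card_alignments (m n : nat) : (#|alignments m n| <= 'C(n, m))%N.
Proof.
pose tab (xi : {ffun 'I_m -> 'I_n}) := [tuple xi i | i < m].
have tab_inj : injective tab.
  move=> xi la eq_tab; apply/ffunP => i.
  by have := congr1 (fun t => tnth t i) eq_tab; rewrite !tnth_mktuple.
rewrite -card_ltn_sorted_tuples -(card_imset _ tab_inj); apply: subset_leq_card.
apply/fintype.subsetP => _ /imsetP[xi /alignmentsP xi_inc ->].
rewrite inE -map_comp sorted_map.
apply: (sub_sorted (e := relpre val ltn)) => [i j|]; first exact: xi_inc.
by rewrite -sorted_map val_enum_ord iota_ltn_sorted.
Qed.

(** One term of the binomial expansion of [(1 + z) ^+ n] at [z = expR (- a)]. *)
Lemma bin_le_expR (R : realType) (n g : nat) (a : R) :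
  'C(n, g)%:R <= expR (n%:R * expR (- a) + g%:R * a).
Proof.
have [gn|ng] := leqP g n; last by rewrite bin_small // expR_ge0.
rewrite expRD -ler_pdivrMr ?expR_gt0 // -expRN -mulrN !expRM_natl.
apply: (@le_trans _ _ ((1 + expR (- a)) ^+ n)).
  rewrite exprDn (bigD1 (Ordinal (gn : (g < n.+1)%N))) //= expr1n mul1r mulr_natl.
  by rewrite lerDl sumr_ge0 // => i _; rewrite expr1n mul1r mulrn_wge0 ?exprn_ge0 ?expR_ge0.
by rewrite lerXn2r ?nnegrE ?addr_ge0 ?expR_ge0 // expR_ge1Dx.
Qed.

(** * Independent fair bits are uniform words *)

Lemma iid_fair_bits_uniform (R : realType) d (T : measurableType d)
    (P : probability T R) (I : finType) (Z : I -> {RV P >-> bool})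
    (Q : {set {ffun I -> bool}}) : iid_bernoulli (1 / 2) Z ->
  P [set w | [ffun k => Z k w] \in Q] = (#|Q|%:R / 2 ^+ #|I|)%:E.
Proof.
move=> [indep law].
pose cyl (f : {ffun I -> bool}) := [set w | forall k, k \in [set: I]%SET -> Z k w = f k].
have half k b : P (Z k @^-1` [set b]) = (1 / 2 : R)%:E.
  have := law k [set b]; rewrite /distribution /pushforward => ->.
  rewrite /bernoulli_prob ifT; last by apply/andP; split; lra.
  by rewrite fsbig_set1; case: b; rewrite /bernoulli_pmf //; congr EFin; field.
have Pcyl f : P (cyl f) = ((1 / 2) ^+ #|I|)%:E.
  have -> := indep [set: I]%SET (fun k => [set f k]) (fun k => Logic.I).
  rewrite (eq_bigr (fun _ => (1 / 2 : R)%:E)) => [|k _]; last exact: half.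
  by rewrite prodEFin prodr_const cardsT.
have mcyl f : measurable (cyl f).
  rewrite (_ : cyl f = \bigcap_(k in [set: I]) (Z k @^-1` [set f k])); last first.
    by apply/seteqP; split=> w /= cw k => [_|/= _]; apply: cw; rewrite // inE.
  apply: fin_bigcap_measurable => // k _.
  rewrite -[X in measurable X]setTI; exact: measurable_funP.
rewrite (_ : [set w | _] = \bigcup_(f in [set` enum Q]) cyl f); last first.
  apply/seteqP; split=> w /= => [Qw|[f /=]].
    by exists [ffun k => Z k w] => [|k _]; rewrite /= ?mem_enum ?ffunE.
  rewrite mem_enum => Qf cw.
  by rewrite (_ : finfun _ = f) //; apply/ffunP => k; rewrite ffunE cw // inE.
rewrite measure_fin_bigcup //=; first last.
- move=> f g _ _ [w [cf cg]]; apply/ffunP => k.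
  by rewrite -cf ?inE // cg ?inE.
rewrite (eq_fsbigr (fun _ => ((1 / 2) ^+ #|I|)%:E)) => [|f _]; last exact: Pcyl.
rewrite -fsbig_seq ?enum_uniq // sumEFin big_enum sumr_const /=.
by congr EFin; rewrite -[LHS]mulr_natl expr_div_n expr1n mul1r.
Qed.

(** * Macroscopic non-uniqueness is unlikely *)

(** Markov's inequality for the uniform distribution on words. *)
Lemma card_macroscopic (R : realType) (m n : nat) (eps t k : R) :
  (m <= n)%N -> 0 < t <= 1 / 2 -> #|alignments m n|%:R <= expR k ->
  t * (m%:R * eps *
       #|[set f : {ffun 'I_m + 'I_n -> bool} |
            m%:R * eps <= (nonuniqueness (f \o inl) (f \o inr))%:R :> R]%SET|%:R) <=
  4 * (2 * k + m%:R * t ^+ 2) * 2 ^+ (m + n).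
Proof.
move=> mn t_int Ak; set Q := [set f | _]%SET.
rewrite exprD; apply: le_trans (mean_nonuniqueness mn t_int Ak).
have /andP[t0 _] := t_int; rewrite ler_pM2l //.
pose split (f : {ffun 'I_m + 'I_n -> bool}) : words m n :=
  ([ffun i => f (inl i)], [ffun j => f (inr j)]).
have split_inj : injective split.
  move=> f g [/ffunP eq1 /ffunP eq2]; apply/ffunP => -[i|j].
    by have := eq1 i; rewrite !ffunE.
  by have := eq2 j; rewrite !ffunE.
rewrite -(card_imset _ split_inj) mulr_natr -sumr_const.
rewrite big_mkcond /=; apply: ler_sum => p _; case: ifP => // /imsetP[f].
rewrite inE => Qf ->; apply: le_trans Qf _ => /=.
rewrite (_ : f \o inl = [ffun i => f (inl i)]); last by apply/funext => i; rewrite ffunE.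
by rewrite (_ : f \o inr = [ffun j => f (inr j)]) //; apply/funext => j; rewrite ffunE.
Qed.

(** The first term is at most [s * n / 3] since [expR a >= a]; in the second, the
    number of gaps is at most [delta * n + 1], and each of these two summands
    contributes at most [s * n / 3]. *)
Lemma entropy_small (R : realType) (s delta : R) (n m : nat) :
  0 < s -> 0 < delta -> delta < s ^+ 2 / 9 -> 9 / s ^+ 2 < n%:R ->
  (m <= n)%N -> (1 - delta) * n%:R < m%:R + 1 ->
  n%:R * expR (- (3 / s)) + (n - m)%:R * (3 / s) <= s * n%:R.
Proof.
move=> s0 d0 d_lt n_gt mn m_gt.
have s_neq0 : s != 0 by rewrite gt_eqF.
have s2 : 0 < s ^+ 2 by rewrite exprn_gt0.
have inv_s : 0 < 3 / s by rewrite divr_gt0.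
have exp_le : expR (- (3 / s)) <= s / 3.
  rewrite -[s / 3]invf_div expRN lef_pV2 ?posrE ?expR_gt0 //.
  by apply: le_trans (expR_ge1Dx _); rewrite lerDr.
have n_gt' : 9 < n%:R * s ^+ 2 by rewrite -ltr_pdivrMr.
have n0 : 0 <= n%:R :> R by [].
have gaps : (n - m)%:R <= s ^+ 2 / 9 * n%:R + 1 by rewrite natrB //; nra.
have main : (n - m)%:R * (3 / s) <= 2 / 3 * (s * n%:R).
  by rewrite mulrA ler_pdivrMr //; nra.
nra.
Qed.

Theorem theorem1p1 (R : realType) (eps : R) (eps_gt0 : 0 < eps) :
  exists (delta0 : R) (n0 : nat), 0 < delta0 /\
    forall (delta : R) (n m : nat),
      0 < delta -> delta < delta0 -> delta < 1 -> (n0 < n)%N ->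
      m%:Z = Num.floor ((1 - delta) * n%:R) ->
      forall (d : measure_display) (T : measurableType d)
        (P : probability T R)
        (X : 'I_m -> {RV P >-> bool}) (Y : 'I_n -> {RV P >-> bool}),
        iid_bernoulli (1 / 2) (join_families X Y) ->
        (P [set w | (m%:R * eps <=
                     (nonuniqueness (X ^~ w) (Y ^~ w))%:R)%R] < eps%:E)%E.
Proof.
(* With these choices, each of the two terms of the bound on E[U] contributes at
   most [eps / 4] to the probability. *)
pose t := Num.min (1 / 2) (eps ^+ 2 / 16); pose s := t * eps ^+ 2 / 64.
have eps2 : 0 < eps ^+ 2 by rewrite exprn_gt0.
have t0 : 0 < t by rewrite lt_min; apply/andP; split; lra.
have t_half : t <= 1 / 2 by rewrite ge_min lexx.
have t_eps : t <= eps ^+ 2 / 16 by rewrite ge_min lexx orbT.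
have s0 : 0 < s by rewrite divr_gt0 ?mulr_gt0.
have s2 : 0 < s ^+ 2 by rewrite exprn_gt0.
(* The constants 1 / 4 and 4 only serve to make [n] at most [2 * m]. *)
exists (Num.min (s ^+ 2 / 9) (1 / 4)), (Num.bound (9 / s ^+ 2) + 4)%N.
split; first by rewrite lt_min; apply/andP; split; lra.
move=> delta n m d0; rewrite lt_min => /andP[d_s d_4] _ n_gt m_floor.
have /andP[m_le m_gt] : m%:R <= (1 - delta) * n%:R < m%:R + 1.
  have := floor_itv ((1 - delta) * n%:R); rewrite -m_floor.
  by rewrite intrD.
have n4 : 4 <= n%:R :> R by rewrite (ler_nat R 4) (leq_trans (leq_addl _ _) (ltnW n_gt)).
have n_s : 9 / s ^+ 2 < n%:R.
  apply: lt_trans (archi_boundP _) _; first by rewrite divr_ge0 // ltW.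
  by rewrite ltr_nat (leq_ltn_trans (leq_addr 4 _) n_gt).
have mn : (m <= n)%N by rewrite -(ler_nat R); nra.
have m_n : n%:R <= 2 * m%:R :> R by nra.
have m0 : 0 < m%:R :> R by lra.
move=> d T P X Y iid.
pose k := n%:R * expR (- (3 / s)) + (n - m)%:R * (3 / s).
have Ak : #|alignments m n|%:R <= expR k.
  apply: le_trans (bin_le_expR _ _ _); rewrite ler_nat bin_sub //.
  exact: card_alignments.
have k_le : k <= m%:R * t * eps ^+ 2 / 32.
  apply: le_trans (entropy_small s0 d0 d_s n_s mn m_gt) _.
  by have := ler_wpM2l (ltW s0) m_n; rewrite /s; lra.
have := @card_macroscopic R m n eps t k mn _ Ak; rewrite t0 t_half => /(_ isT).
set Q := [set f | _]%SET => Q_le.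
have splitE w : let f := [ffun i => join_families X Y i w] in
    nonuniqueness (f \o inl) (f \o inr) = nonuniqueness (X ^~ w) (Y ^~ w).
  have ffun_id (J : finType) (F : J -> bool) : [ffun i => F i] = F :> (J -> bool).
    by apply/funext => i; rewrite ffunE.
  by rewrite /= (ffun_id _ (fun i => join_families X Y i w)).
rewrite (_ : [set w | _] =
    [set w | [ffun i => join_families X Y i w] \in Q]); last first.
  by apply/seteqP; split=> w /=; rewrite inE (splitE w).
rewrite iid_fair_bits_uniform // card_sum !card_ord lte_fin.
rewrite ltr_pdivrMr ?exprn_gt0 //.
have N0 : 0 < 2 ^+ (m + n) :> R by rewrite exprn_gt0.
set N := 2 ^+ (m + n) in Q_le N0 *; set q := #|Q|%:R in Q_le *.
have mte : 0 < t * m%:R * eps by rewrite !mulr_gt0.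
rewrite -(ltr_pM2l mte); apply: (@le_lt_trans _ _ (t * (m%:R * eps * q))).
  by rewrite !mulrA.
apply: le_lt_trans Q_le _; rewrite [X in _ < X]mulrA ltr_pM2r //.
have mt : 0 < m%:R * t by rewrite mulr_gt0.
have : m%:R * t * t <= m%:R * t * (eps ^+ 2 / 16) by rewrite ler_pM2l.
have : 0 < m%:R * t * eps ^+ 2 by rewrite mulr_gt0.
move: k_le; rewrite !expr2; nra.
Qed.
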